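(* In the setting of the context, let the precoders be the central zero-forcing (CZF) precoders $$\bar{\mathbf w}_{sk}=\big[\bar{\mathbf H}_1(\bar{\mathbf H}_1^H\bar{\mathbf H}_1)^{-1}\big]_{(r_s,k)},\qquad \tilde{\mathbf w}_{sj}=\big[\tilde{\mathbf G}(\tilde{\mathbf G}^H\tilde{\mathbf G})^{-1}\big]_{(r_s,j)},$$ and let the power-control coefficients not depend on the subarray: $\bar\eta_{sk}=\bar\eta_k$ and $\tilde\eta_{sj}=\tilde\eta_j$ for all $s$. Then the spectral efficiency $\overline{\mathrm{SE}}_k$ of every near-field user $k\in\mathcal{K_N}$ is $\overline{\mathrm{SE}}_k=\log_2(1+\overline{\mathrm{SINR}}_k)$ with $$\overline{\mathrm{SINR}}_k=\frac{P_n\bar\eta_k\Big|\sum_{s\in\bar{\mathcal S}_k}\bar{\mathbf g}_{sk}^H\bar{\mathbf w}_{sk}\Big|^2}{\bar\Delta+\sigma_k^2},\qquad \bar\Delta=P_n\sum_{i\in\mathcal{K_N}\setminus\{k\}}\bar\eta_i\Big|\sum_{s\in\bar{\mathcal S}_i}\bar{\mathbf g}_{sk}^H\bar{\mathbf w}_{si}\Big|^2+P_f\sum_{j\in\mathcal{K_F}}\tilde\eta_j\,r_{kj},$$ where $$r_{kj}=\Re\Big\{\sum_{s\in\tilde{\mathcal S}_j}\sum_{s'\in\tilde{\mathcal S}_j}\bar{\mathbf g}_{sk}^H\,\mathbb E\big\{\tilde{\mathbf w}_{sj}\tilde{\mathbf w}_{s'j}^H\big\}\,\bar{\mathbf g}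_{s'k}\Big\}.$$
   Context: Array and users. A base-station planar array has $M=M_xM_y$ antennas ($M_x,M_y$ odd), spacing $d=\lambda/2$, wavelength $\lambda>0$, partitioned into $S$ subarrays of $M^\ast=M/S$ antennas each; subarray $s\in\mathcal S=\{1,\dots,S\}$ consists of the antennas with indices $r_s=\{(s-1)M^\ast+1,\dots,sM^\ast\}$. Near-field users: $\mathcal{K_N}=\{1,\dots,K_n\}$; far-field users: $\mathcal{K_F}=\{1,\dots,K_f\}$. A reconfigurable intelligent surface (RIS) has $N=N_1N_2$ elements and fixed phase matrix $\boldsymbol\Theta=\mathrm{diag}(e^{j\theta_1},\dots,e^{j\theta_N})$, $\theta_n\in[0,2\pi)$ real. Near-field channels (deterministic, line of sight). Antenna $m$ has coordinates $(m_xd,m_yd,0)$ with $m_x=-\frac{M_x-1}{2}+((m-1)\bmod M_x)$, $m_y=\frac{M_y-1}{2}-\lfloor (m-1)/M_x\rfloor$. User $k\in\mathcal{K_N}$ is at $(u_{k,x},u_{k,y},u_{k,z})$, $u_{k,z}>0$. Put $r_{m,k}=\sqrt{(u_{k,x}-m_xd)^2+(u_{k,y}-m_yd)^2+u_{k,z}^2}$, and $\bar g_{m,k}=\sqrt{\frac{A}{4\pi}\frac{u_{k,z}((u_{k,x}-m_xd)^2+u_{k,z}^2)}{r_{m,k}^5}}\;e^{-j2\pi r_{m,k}/\lambda}$ with $A=\lambda^2/(4\pi)$. The channel of subarray $s$ to user $k$ is $\bar{\mathbf g}_{sk}=[\bar g_{m,k}]_{m\in r_s}\in\mathbb C^{M^\ast}$;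 $\bar{\mathbf g}_k\in\mathbb C^M$ stacks $\bar{\mathbf g}_{1k},\dots,\bar{\mathbf g}_{Sk}$, and $\bar{\mathbf H}_1=[\bar{\mathbf g}_1,\dots,\bar{\mathbf g}_{K_n}]\in\mathbb C^{M\times K_n}$. Far-field channels. The array-to-RIS channel is $\mathbf H_2=\alpha_2\bar{\mathbf H}_2+\beta_2\tilde{\mathbf H}_2\in\mathbb C^{N\times M}$, where $\alpha_2=\sqrt{\iota\zeta/(\iota+1)}$, $\beta_2=\sqrt{\zeta/(\iota+1)}$ with $\iota\geq 0,\zeta>0$; $\bar{\mathbf H}_2=\mathbf b_N(\varphi^a,\varphi^e)\mathbf a_M(\phi^a,\phi^e)^H$ is deterministic, and $\tilde{\mathbf H}_2$ has i.i.d. $\mathcal{CN}(0,1)$ (circularly symmetric) entries. Here, with fixed real angles, $\mathbf a_M(\phi^a,\phi^e)=[e^{j2\pi m d\cos\phi^e\sin\phi^a/\lambda}]_{m=0}^{M_x-1}\otimes[e^{j2\pi m d\sin\phi^e/\lambda}]_{m=0}^{M_y-1}$ and $\mathbf b_N(\varphi^a,\varphi^e)=[e^{j2\pi n d_R\cos\varphi^e\sin\varphi^a/\lambda}]_{n=0}^{N_1-1}\otimes[e^{j2\pi n d_R\sin\varphi^e/\lambda}]_{n=0}^{N_2-1}$ (column vectors), $d_R=\lambda/2$. The RIS-to-user channel of $k\in\mathcal{K_F}$ is $\mathbf h_k=\sqrt{\varsigma_k}\,\mathbf b_N(\vartheta_k^a,\vartheta_k^e)\in\mathbb C^N$, $\varsigma_k>0$;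 the cascaded channel is $\tilde{\mathbf g}_k^H=\mathbf h_k^H\boldsymbol\Theta\mathbf H_2$, and $\tilde{\mathbf G}=[\tilde{\mathbf g}_1,\dots,\tilde{\mathbf g}_{K_f}]\in\mathbb C^{M\times K_f}$. $[\mathbf A]_{(r_s,k)}$ denotes the part of the $k$th column of $\mathbf A$ with row indices in $r_s$. It is assumed that $\bar{\mathbf H}_1^H\bar{\mathbf H}_1$ is invertible, $\tilde{\mathbf G}^H\tilde{\mathbf G}$ is almost surely invertible, and the precoders $\tilde{\mathbf w}_{sj}$ have finite second moments. Visibility regions and powers. $\bar{\mathcal S}_k\subseteq\mathcal S$ ($k\in\mathcal{K_N}$) and $\tilde{\mathcal S}_j\subseteq\mathcal S$ ($j\in\mathcal{K_F}$) are given sets of subarrays serving each user (visibility regions). $P_n,P_f>0$ are powers, $\bar\eta_{sk},\tilde\eta_{sj}\ge0$ are power-control coefficients, $\sigma_k^2>0$ is the noise power. Spectral efficiency of near-field user $k$ for given precoders $\bar{\mathbf w}_{sk},\tilde{\mathbf w}_{sj}\in\mathbb C^{M^\ast}$: by definition $\overline{\mathrm{SE}}_k=\log_2(1+\overline{\mathrm{SINR}}_k)$, where $$\overline{\mathrm{SINR}}_k=\frac{|\overline{\mathrm{DS}}_k|^2}{\sum_{i\in\mathcal{K_N}\setminus\{k\}}|\overline{\mathrm{UI}}^{\mathrm N}_i|^2+\sum_{j\in\mathcal{K_F}}\mathbb E\{|\overline{\mathrm{UI}}^{\mathrm F}_j|^2\}+\sigma_k^2},$$ $\overline{\mathrm{DS}}_k=\sqrt{P_n}\sum_{s\in\bar{\mathcal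 S}_k}\sqrt{\bar\eta_{sk}}\bar{\mathbf g}_{sk}^H\bar{\mathbf w}_{sk}$, $\overline{\mathrm{UI}}^{\mathrm N}_i=\sqrt{P_n}\sum_{s\in\bar{\mathcal S}_i}\sqrt{\bar\eta_{si}}\bar{\mathbf g}_{sk}^H\bar{\mathbf w}_{si}$, $\overline{\mathrm{UI}}^{\mathrm F}_j=\sqrt{P_f}\sum_{s\in\tilde{\mathcal S}_j}\sqrt{\tilde\eta_{sj}}\bar{\mathbf g}_{sk}^H\tilde{\mathbf w}_{sj}$. Expectations are over $\tilde{\mathbf H}_2$. *)

(* Defs.v *)
From HB Require Import structures.
From mathcomp Require Import all_boot all_order all_algebra.
From mathcomp Require Import sesquilinear spectral complex.
From mathcomp Require Import all_classical all_reals all_analysis.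
Set Implicit Arguments.
Unset Strict Implicit.
Unset Printing Implicit Defensive.
Import Order.TTheory GRing.Theory Num.Theory.
Import numFieldNormedType.Exports.
Local Open Scope classical_set_scope.
Local Open Scope sesquilinear_scope.
Local Open Scope complex_scope.
Local Open Scope ring_scope.

Definition log2 (R : realType) (x : R) : R := ln x / ln 2.

(* e^{j x} for a real phase x. *)
Definition expj (R : realType) (x : R) : R[i] := cos x +i* sin x.

(* |z| as an element of R (the norm of the numFieldType R[i] is R[i]-valued). *)
Definition cabs (R : realType) (z : R[i]) : R := ComplexField.Normc.normc z.

(* u^H v *)
Definition hdot (R : realType) n (u v : 'cV[R[i]]_n) : R[i] :=
  (u ^t* *m v) ord0 ord0.

(* Kronecker product of column vectors: mxvec is row-major, so the entry of
   index p * n + q is a_p * b_q. *)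
Definition kron (R : realType) m n (a : 'cV[R[i]]_m) (b : 'cV[R[i]]_n) :
    'cV[R[i]]_(m * n) := (mxvec (a *m b^T))^T.

(* Steering vector of a planar m x n array, spacing dx, wavelength l. *)
Definition steering (R : realType) (l dx : R) (m n : nat) (az el : R) :
    'cV[R[i]]_(m * n) :=
  kron (\col_(p < m) expj (2 * pi * p%:R * dx * cos el * sin az / l))
       (\col_(q < n) expj (2 * pi * q%:R * dx * sin el / l)).

Section Probability.
Context d (Omega : measurableType d) (R : realType) (P : probability Omega R).

Definition mutually_independent d' (T : measurableType d') (I : finType)
    (X : I -> Omega -> T) : Prop :=
  forall (J : {set I}) (B : I -> set T), (forall i, measurable (B i)) ->
    P (\bigcap_(i in [set` J]) (X i @^-1` B i)) =
    (\prod_(i in J) fine (P (X i @^-1` B i)))%:E.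

Definition has_normal_law (m s : R) (X : Omega -> R) : Prop :=
  measurable_fun setT X /\
  forall A : set R, measurable A -> P (X @^-1` A) = normal_prob m s A.

(* CN(0,1): independent real and imaginary parts, both N(0, 1/2)
   (the second parameter of normal_prob is the standard deviation). *)
Definition std_complex_gaussian (Z : Omega -> R[i]) : Prop :=
  [/\ has_normal_law 0 (Num.sqrt 2^-1) (fun w => complex.Re (Z w)),
      has_normal_law 0 (Num.sqrt 2^-1) (fun w => complex.Im (Z w)) &
      mutually_independent (fun (b : bool) w =>
        if b then complex.Re (Z w) else complex.Im (Z w))].

(* Independence of the entries as random variables in C, identified with
   R * R carrying the product (= Borel) sigma-algebra. *)
Definition iid_complex_gaussian m n (X : Omega -> 'M[R[i]]_(m, n)) : Prop :=
  (forall i j, std_complex_gaussian (fun w => X w i j)) /\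
  mutually_independent (fun (ij : 'I_m * 'I_n) w =>
    (complex.Re (X w ij.1 ij.2), complex.Im (X w ij.1 ij.2))).

Definition expect (X : Omega -> R) : R := fine 'E_P[X].

Definition expect_mx m n (X : Omega -> 'M[R[i]]_(m, n)) : 'M[R[i]]_(m, n) :=
  \matrix_(i, j) (expect (fun w => complex.Re (X w i j)) +i*
                  expect (fun w => complex.Im (X w i j))).

Definition finite_second_moment n (X : Omega -> 'cV[R[i]]_n) : Prop :=
  forall i, ('E_P[fun w => (cabs (X w i ord0) ^+ 2)%R] < +oo)%E.

End Probability.

(* The deterministic data.  Indices are 0-based throughout: antenna m, subarray
   s and user k of the 1-based convention have ordinals m-1, s-1, k-1. *)
Record setting (R : realType) := Setting {
  Mx : nat;
  My : nat;
  Mx_odd : odd Mx;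
  My_odd : odd My;
  nS : nat;
  nS_dvd : (nS %| Mx * My)%N;
  Kn : nat;
  Kf : nat;
  N1 : nat;
  N2 : nat;
  wavelength : R;
  wavelength_gt0 : 0 < wavelength;
  ux : 'I_Kn -> R;
  uy : 'I_Kn -> R;
  uz : 'I_Kn -> R;
  uz_gt0 : forall k, 0 < uz k;
  theta : 'I_(N1 * N2) -> R;                   (* RIS phases *)
  theta_bounds : forall n, 0 <= theta n < 2 * pi;
  rician : R;                                  (* iota *)
  rician_ge0 : 0 <= rician;
  zeta : R;
  zeta_gt0 : 0 < zeta;
  bs_az : R;                                   (* phi^a *)
  bs_el : R;                                   (* phi^e *)
  ris_az : R;                                  (* varphi^a *)
  ris_el : R;                                  (* varphi^e *)
  user_az : 'I_Kf -> R;                        (* vartheta_k^a *)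
  user_el : 'I_Kf -> R;                        (* vartheta_k^e *)
  varsigma : 'I_Kf -> R;
  varsigma_gt0 : forall k, 0 < varsigma k;
  VRn : 'I_Kn -> {set 'I_nS};                  (* visibility regions *)
  VRf : 'I_Kf -> {set 'I_nS};
  Pn : R;
  Pn_gt0 : 0 < Pn;
  Pf : R;
  Pf_gt0 : 0 < Pf;
  etan : 'I_nS -> 'I_Kn -> R;                  (* power control *)
  etan_ge0 : forall s k, 0 <= etan s k;
  etaf : 'I_nS -> 'I_Kf -> R;
  etaf_ge0 : forall s j, 0 <= etaf s j;
  noise : 'I_Kn -> R;                          (* sigma_k^2 *)
  noise_gt0 : forall k, 0 < noise k
}.

Section Model.
Context (R : realType) (p : setting R).

Definition nM : nat := (Mx p * My p)%N.
Definition nN : nat := (N1 p * N2 p)%N.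
Definition Mstar : nat := (nM %/ nS p)%N.

Fact antenna_subproof (s : 'I_(nS p)) (i : 'I_Mstar) :
  (s * Mstar + i < nM)%N.
Proof.
have -> : nM = (nS p * Mstar)%N by rewrite mulnC divnK ?nS_dvd.
apply: (@leq_trans (s.+1 * Mstar)%N); last by rewrite leq_mul2r ltn_ord orbT.
by rewrite mulSn addnC ltn_add2r.
Qed.

Definition antenna (s : 'I_(nS p)) (i : 'I_Mstar) : 'I_nM :=
  Ordinal (antenna_subproof s i).

(* [A]_(r_s, k) *)
Definition subcol n (s : 'I_(nS p)) (k : 'I_n) (A : 'M[R[i]]_(nM, n)) :
    'cV[R[i]]_Mstar := rowsub (antenna s) (col k A).

Definition spacing : R := wavelength p / 2.

Definition mx_coord (m : 'I_nM) : R :=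
  - (((Mx p)%:R - 1) / 2) + (m %% Mx p)%:R.
Definition my_coord (m : 'I_nM) : R :=
  ((My p)%:R - 1) / 2 - (m %/ Mx p)%:R.

Definition dist (m : 'I_nM) (k : 'I_(Kn p)) : R :=
  Num.sqrt ((ux k - mx_coord m * spacing) ^+ 2 +
            (uy k - my_coord m * spacing) ^+ 2 + uz k ^+ 2).

Definition aperture : R := wavelength p ^+ 2 / (4 * pi).

Definition gbar_entry (m : 'I_nM) (k : 'I_(Kn p)) : R[i] :=
  (Num.sqrt (aperture / (4 * pi) *
     (uz k * ((ux k - mx_coord m * spacing) ^+ 2 + uz k ^+ 2) /
      dist m k ^+ 5)))%:C
  * expj (- (2 * pi * dist m k / wavelength p)).

Definition H1 : 'M[R[i]]_(nM, Kn p) := \matrix_(m, k) gbar_entry m k.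

Definition gbar (s : 'I_(nS p)) (k : 'I_(Kn p)) : 'cV[R[i]]_Mstar :=
  subcol s k H1.

Definition alpha2 : R := Num.sqrt (rician p * zeta p / (rician p + 1)).
Definition beta2 : R := Num.sqrt (zeta p / (rician p + 1)).

Definition aM : 'cV[R[i]]_nM :=
  steering (wavelength p) spacing (Mx p) (My p) (bs_az p) (bs_el p).

(* The RIS element spacing d_R is wavelength / 2, as for the array. *)
Definition bN (az el : R) : 'cV[R[i]]_nN :=
  steering (wavelength p) (wavelength p / 2) (N1 p) (N2 p) az el.

Definition H2bar : 'M[R[i]]_(nN, nM) :=
  bN (ris_az p) (ris_el p) *m aM ^t*.

Definition H2 (Htil : 'M[R[i]]_(nN, nM)) : 'M[R[i]]_(nN, nM) :=
  (alpha2)%:C *: H2bar + (beta2)%:C *: Htil.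

Definition Theta : 'M[R[i]]_nN := diag_mx (\row_(n < nN) expj (@theta R p n)).

Definition h (k : 'I_(Kf p)) : 'cV[R[i]]_nN :=
  (Num.sqrt (varsigma k))%:C *: bN (user_az k) (user_el k).

Definition gtil (Htil : 'M[R[i]]_(nN, nM)) (k : 'I_(Kf p)) : 'cV[R[i]]_nM :=
  ((h k) ^t* *m Theta *m H2 Htil) ^t*.

Definition Gtil (Htil : 'M[R[i]]_(nN, nM)) : 'M[R[i]]_(nM, Kf p) :=
  \matrix_(m, k) gtil Htil k m ord0.

Definition czf n (A : 'M[R[i]]_(nM, n)) : 'M[R[i]]_(nM, n) :=
  A *m invmx (A ^t* *m A).

Definition wbar_czf (s : 'I_(nS p)) (k : 'I_(Kn p)) : 'cV[R[i]]_Mstar :=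
  subcol s k (czf H1).

Definition wtil_czf (Htil : 'M[R[i]]_(nN, nM))
    (s : 'I_(nS p)) (j : 'I_(Kf p)) : 'cV[R[i]]_Mstar :=
  subcol s j (czf (Gtil Htil)).

Section SpectralEfficiency.
Context d (Omega : measurableType d) (P : probability Omega R).
Variables (wbar : 'I_(nS p) -> 'I_(Kn p) -> 'cV[R[i]]_Mstar)
          (wtil : Omega -> 'I_(nS p) -> 'I_(Kf p) -> 'cV[R[i]]_Mstar).

(* UIn k i is the signal of near-field user i received by user k. *)
Definition UIn (k i : 'I_(Kn p)) : R[i] :=
  (Num.sqrt (Pn p))%:C *
  \sum_(s in VRn i) (Num.sqrt (etan s i))%:C * hdot (gbar s k) (wbar s i).

Definition DS (k : 'I_(Kn p)) : R[i] :=
  (Num.sqrt (Pn p))%:C *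
  \sum_(s in VRn k) (Num.sqrt (etan s k))%:C * hdot (gbar s k) (wbar s k).

Definition UIf (k : 'I_(Kn p)) (j : 'I_(Kf p)) (w : Omega) : R[i] :=
  (Num.sqrt (Pf p))%:C *
  \sum_(s in VRf j) (Num.sqrt (etaf s j))%:C * hdot (gbar s k) (wtil w s j).

Definition SINR (k : 'I_(Kn p)) : R :=
  cabs (DS k) ^+ 2 /
  (\sum_(i | i != k) cabs (UIn k i) ^+ 2 +
   \sum_j expect P (fun w => cabs (UIf k j w) ^+ 2) +
   noise k).

Definition SE (k : 'I_(Kn p)) : R := log2 (1 + SINR k).

Definition rcoef (k : 'I_(Kn p)) (j : 'I_(Kf p)) : R :=
  complex.Re (\sum_(s in VRf j) \sum_(s' in VRf j)
    hdot (gbar s k)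
      (expect_mx P (fun w => wtil w s j *m (wtil w s' j) ^t*) *m gbar s' k)).

End SpectralEfficiency.
End Model.

(* Main.v *)
(* Since the power coefficients do not depend on s, they leave the squared
   modulus, and |sum_s g_s^H w_s|^2 = sum_s sum_s' g_s^H (w_s w_s'^H) g_s'.  The
   expectation passes through this finite sum because every product
   w_si * conj w_s'i' is integrable: it is dominated by |w_si|^2 + |w_s'i'|^2, and
   it is measurable because the zero-forcing precoder is a rational function of
   the Gaussian entries. *)
Require Import Defs.
From mathcomp Require Import all_boot all_order all_algebra.
From mathcomp Require Import sesquilinear spectral complex.
From mathcomp Require Import measurable_realfun lra.
From mathcomp Require Import all_classical all_reals all_analysis.
Set Implicit Arguments.
Unset Strict Implicit.
Unset Printing Implicit Defensive.
Import Order.TTheory GRing.Theory Num.Theory.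
Import numFieldNormedType.Exports.
Local Open Scope classical_set_scope.
Local Open Scope sesquilinear_scope.
Local Open Scope complex_scope.
Local Open Scope ring_scope.

(** * Complex-valued functions: coordinates and measurability *)

Section ComplexRandomVariables.
Context {R : realType} {d : measure_display} {Omega : measurableType d}.
Implicit Types (f g : Omega -> R[i]).

Lemma cabs_sqrE (z : R[i]) :
  cabs z ^+ 2 = complex.Re z ^+ 2 + complex.Im z ^+ 2.
Proof. by case: z => a b /=; rewrite sqr_sqrtr // addr_ge0 ?sqr_ge0. Qed.

Lemma cabs_sqr_Re (z : R[i]) : cabs z ^+ 2 = complex.Re (z * Num.conj z).
Proof. by rewrite cabs_sqrE; case: z => a b /=; rewrite mulrN opprK !expr2. Qed.

Lemma ReD (x y : R[i]) : complex.Re (x + y) = complex.Re x + complex.Re y.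
Proof. by case: x; case: y. Qed.

Lemma ImD (x y : R[i]) : complex.Im (x + y) = complex.Im x + complex.Im y.
Proof. by case: x; case: y. Qed.

Lemma ReM (x y : R[i]) : complex.Re (x * y) =
  complex.Re x * complex.Re y - complex.Im x * complex.Im y.
Proof. by case: x; case: y. Qed.

Lemma ImM (x y : R[i]) : complex.Im (x * y) =
  complex.Re x * complex.Im y + complex.Im x * complex.Re y.
Proof. by case: x; case: y. Qed.

Lemma ReJ (x : R[i]) : complex.Re (Num.conj x) = complex.Re x.
Proof. by case: x. Qed.

Lemma ImJ (x : R[i]) : complex.Im (Num.conj x) = - complex.Im x.
Proof. by case: x. Qed.

Lemma ReV (x : R[i]) : complex.Re x^-1 = complex.Re x / cabs x ^+ 2.
Proof. by rewrite cabs_sqrE; case: x. Qed.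

Lemma ImV (x : R[i]) : complex.Im x^-1 = - complex.Im x / cabs x ^+ 2.
Proof. by rewrite cabs_sqrE mulNr; case: x. Qed.

(** Measurability in coordinates is the form in which the Gaussian hypothesis on the channel entries
    provides it, with [R[i]] read as the plane. *)
Definition cmeasurable f :=
  measurable_fun setT (fun w => complex.Re (f w)) /\
  measurable_fun setT (fun w => complex.Im (f w)).

Lemma cmeasurable_cst (c : R[i]) : cmeasurable (fun _ => c).
Proof. by split; exact: measurable_cst. Qed.

Lemma cmeasurableD f g :
  cmeasurable f -> cmeasurable g -> cmeasurable (fun w => f w + g w).
Proof.
move=> [f1 f2] [g1 g2]; split.
  by under eq_fun do rewrite ReD; exact: measurable_funD.
by under eq_fun do rewrite ImD; exact: measurable_funD.
Qed.

Lemma cmeasurableM f g :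
  cmeasurable f -> cmeasurable g -> cmeasurable (fun w => f w * g w).
Proof.
move=> [f1 f2] [g1 g2]; split.
  by under eq_fun do rewrite ReM; apply: measurable_funB; exact: measurable_funM.
by under eq_fun do rewrite ImM; apply: measurable_funD; exact: measurable_funM.
Qed.

Lemma cmeasurable_conj f :
  cmeasurable f -> cmeasurable (fun w => Num.conj (f w)).
Proof.
move=> [f1 f2]; split.
  by under eq_fun do rewrite ReJ.
by under eq_fun do rewrite ImJ; exact: measurable_funN.
Qed.

Lemma cmeasurable_inv f : cmeasurable f -> cmeasurable (fun w => (f w)^-1).
Proof.
move=> [f1 f2].
have m2 : measurable_fun setT (fun w => cabs (f w) ^+ 2).
  under eq_fun do rewrite cabs_sqrE.
  by apply: measurable_funD; exact: measurable_funX.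
have mV : measurable_fun setT (fun w => (cabs (f w) ^+ 2)^-1).
  under eq_fun do rewrite -powR_inv1 ?sqr_ge0 //.
  exact: (measurableT_comp (measurable_powR (- 1)) m2).
split; first by under eq_fun do rewrite ReV; exact: measurable_funM.
under eq_fun do rewrite ImV.
by apply: measurable_funM => //; exact: measurable_funN.
Qed.

Lemma cmeasurable_sum (I : Type) (r : seq I) (Q : pred I) (F : I -> Omega -> R[i]) :
  (forall i, cmeasurable (F i)) -> cmeasurable (fun w => \sum_(i <- r | Q i) F i w).
Proof.
move=> mF; elim: r => [|i r IH].
  by under eq_fun do rewrite big_nil; exact: cmeasurable_cst.
under eq_fun do rewrite big_cons.
by case: (Q i) => //; exact: cmeasurableD.
Qed.

Lemma cmeasurable_prod (I : Type) (r : seq I) (Q : pred I) (F : I -> Omega -> R[i]) :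
  (forall i, cmeasurable (F i)) -> cmeasurable (fun w => \prod_(i <- r | Q i) F i w).
Proof.
move=> mF; elim: r => [|i r IH].
  by under eq_fun do rewrite big_nil; exact: cmeasurable_cst.
under eq_fun do rewrite big_cons.
by case: (Q i) => //; exact: cmeasurableM.
Qed.

Lemma cmeasurable_if (b : Omega -> bool) f g : measurable_fun setT b ->
  cmeasurable f -> cmeasurable g -> cmeasurable (fun w => if b w then f w else g w).
Proof.
move=> mb [f1 f2] [g1 g2]; split.
  by under eq_fun do rewrite (fun_if (@complex.Re R)); exact: measurable_fun_ifT.
by under eq_fun do rewrite (fun_if (@complex.Im R)); exact: measurable_fun_ifT.
Qed.

(** Serves the case distinction of [invmx], which over a field tests whether the determinant
    vanishes. *)
Lemma measurable_fun_cneq0 f :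
  cmeasurable f -> measurable_fun setT (fun w => f w != 0).
Proof.
move=> [f1 f2].
under eq_fun do rewrite eq_complex /=.
apply: measurable_neg; apply: measurable_and.
  by apply: measurable_fun_eqr => //; exact: measurable_cst.
by apply: measurable_fun_eqr => //; exact: measurable_cst.
Qed.

(** * Measurability of matrix operations *)

Definition mx_measurable m n (A : Omega -> 'M[R[i]]_(m, n)) :=
  forall i j, cmeasurable (fun w => A w i j).

Lemma mx_measurable_cst m n (A : 'M[R[i]]_(m, n)) : mx_measurable (fun=> A).
Proof. by move=> i j; exact: cmeasurable_cst. Qed.

Lemma mx_measurableD m n (A B : Omega -> 'M[R[i]]_(m, n)) :
  mx_measurable A -> mx_measurable B -> mx_measurable (fun w => A w + B w).
Proof.
by move=> mA mB i j; under eq_fun do rewrite mxE; exact: cmeasurableD.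
Qed.

Lemma mx_measurableZ m n (a : Omega -> R[i]) (A : Omega -> 'M[R[i]]_(m, n)) :
  cmeasurable a -> mx_measurable A -> mx_measurable (fun w => a w *: A w).
Proof.
by move=> ma mA i j; under eq_fun do rewrite mxE; exact: cmeasurableM.
Qed.

Lemma mx_measurableM m n l (A : Omega -> 'M[R[i]]_(m, n))
    (B : Omega -> 'M[R[i]]_(n, l)) :
  mx_measurable A -> mx_measurable B -> mx_measurable (fun w => A w *m B w).
Proof.
move=> mA mB i j; under eq_fun do rewrite mxE.
by apply: cmeasurable_sum => s; exact: cmeasurableM.
Qed.

Lemma mx_measurable_adjoint m n (A : Omega -> 'M[R[i]]_(m, n)) :
  mx_measurable A -> mx_measurable (fun w => (A w) ^t*).
Proof.
by move=> mA i j; under eq_fun do rewrite !mxE; exact: cmeasurable_conj.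
Qed.

(** By the Leibniz formula the determinant is a finite signed sum of products of entries. *)
Lemma cmeasurable_det n (A : Omega -> 'M[R[i]]_n) :
  mx_measurable A -> cmeasurable (fun w => \det (A w)).
Proof.
move=> mA; apply: cmeasurable_sum => s.
by apply: cmeasurableM; [exact: cmeasurable_cst | exact: cmeasurable_prod].
Qed.

(** Cofactors are signed minors; together with the determinant they give the inverse by Cramer's
    formula. *)
Lemma mx_measurable_adj n (A : Omega -> 'M[R[i]]_n) :
  mx_measurable A -> mx_measurable (fun w => \adj (A w)).
Proof.
move=> mA i j; under eq_fun do rewrite mxE.
apply: cmeasurableM; first exact: cmeasurable_cst.
by apply: cmeasurable_det => s t; under eq_fun do rewrite !mxE.
Qed.

(* invmx is the identity on singular matrices, so this holds without any
   invertibility assumption, even almost sure. *)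
Lemma mx_measurable_inv n (A : Omega -> 'M[R[i]]_n) :
  mx_measurable A -> mx_measurable (fun w => invmx (A w)).
Proof.
move=> mA i j; have mdet := cmeasurable_det mA.
under eq_fun do rewrite /invmx unitmxE unitfE (fun_if (fun B : 'M[R[i]]_n => B i j)).
apply: cmeasurable_if; [exact: measurable_fun_cneq0| |exact: mA].
by apply: mx_measurableZ; [exact: cmeasurable_inv | exact: mx_measurable_adj].
Qed.

(** * Integrability and expectation of complex random variables *)

Context (P : probability Omega R).

Lemma expectE (X : Omega -> R) : expect P X = Rintegral P setT X.
Proof. by rewrite /expect unlock. Qed.

Definition cintegrable f :=
  P.-integrable setT (EFin \o (fun w => complex.Re (f w))) /\
  P.-integrable setT (EFin \o (fun w => complex.Im (f w))).

(** Has the shape of the entries of [expect_mx], so that correlation matrices are read entrywise as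
    [cexpect] of products. *)
Definition cexpect f : R[i] :=
  expect P (fun w => complex.Re (f w)) +i* expect P (fun w => complex.Im (f w)).

Lemma integrableD_EFin (X Y : Omega -> R) :
  P.-integrable setT (EFin \o X) -> P.-integrable setT (EFin \o Y) ->
  P.-integrable setT (EFin \o (fun w => X w + Y w)).
Proof. by move=> iX iY; exact: (integrableD measurableT iX iY). Qed.

Lemma integrableZ_EFin (c : R) (X : Omega -> R) :
  P.-integrable setT (EFin \o X) ->
  P.-integrable setT (EFin \o (fun w => c * X w)).
Proof. by move=> iX; exact: (integrableZl measurableT c iX). Qed.

Lemma expectD (X Y : Omega -> R) :
  P.-integrable setT (EFin \o X) -> P.-integrable setT (EFin \o Y) ->
  expect P (fun w => X w + Y w) = expect P X + expect P Y.
Proof. by move=> iX iY; rewrite !expectE RintegralD. Qed.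

Lemma expectZ (c : R) (X : Omega -> R) :
  P.-integrable setT (EFin \o X) -> expect P (fun w => c * X w) = c * expect P X.
Proof. by move=> iX; rewrite !expectE RintegralZl. Qed.

Lemma cintegrableD f g :
  cintegrable f -> cintegrable g -> cintegrable (fun w => f w + g w).
Proof.
move=> [f1 f2] [g1 g2]; split.
  by under eq_fun do rewrite /= ReD; exact: integrableD_EFin.
by under eq_fun do rewrite /= ImD; exact: integrableD_EFin.
Qed.

Lemma cexpectD f g : cintegrable f -> cintegrable g ->
  cexpect (fun w => f w + g w) = cexpect f + cexpect g.
Proof.
move=> [f1 f2] [g1 g2]; rewrite /cexpect.
under eq_fun do rewrite ReD.
by under [X in _ +i* expect P X]eq_fun do rewrite ImD; rewrite !expectD.
Qed.

Lemma cintegrableZ (c : R[i]) f :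
  cintegrable f -> cintegrable (fun w => c * f w).
Proof.
move=> [f1 f2]; split.
  (* The minus sign is moved into the constant, so that additivity and real scaling suffice. *)
  under eq_fun do rewrite /= ReM -mulNr.
  by apply: integrableD_EFin; exact: integrableZ_EFin.
under eq_fun do rewrite /= ImM.
by apply: integrableD_EFin; exact: integrableZ_EFin.
Qed.

Lemma cexpectZ (c : R[i]) f : cintegrable f ->
  cexpect (fun w => c * f w) = c * cexpect f.
Proof.
move=> [f1 f2]; rewrite /cexpect.
under eq_fun do rewrite ReM -mulNr.
under [X in _ +i* expect P X]eq_fun do rewrite ImM.
rewrite !expectD ?expectZ //; try exact: integrableZ_EFin.
by case: c => a b /=; rewrite mulNr.
Qed.

Lemma cintegrable0 : cintegrable (fun=> 0).
Proof. by split; exact: (integrable0 P setT). Qed.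

Lemma cexpect0 : cexpect (fun=> 0) = 0.
Proof. by rewrite /cexpect !expectE Rintegral_cst //= mul0r. Qed.

Lemma cintegrable_sum (I : Type) (r : seq I) (Q : pred I)
    (F : I -> Omega -> R[i]) : (forall i, cintegrable (F i)) ->
  cintegrable (fun w => \sum_(i <- r | Q i) F i w).
Proof.
move=> iF; elim: r => [|i r IH].
  by under eq_fun do rewrite big_nil; exact: cintegrable0.
under eq_fun do rewrite big_cons.
by case: (Q i) => //; exact: cintegrableD.
Qed.

Lemma cexpect_sum (I : Type) (r : seq I) (Q : pred I)
    (F : I -> Omega -> R[i]) : (forall i, cintegrable (F i)) ->
  cexpect (fun w => \sum_(i <- r | Q i) F i w) =
  \sum_(i <- r | Q i) cexpect (F i).
Proof.
move=> iF; elim: r => [|i r IH].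
  by under eq_fun do rewrite big_nil; rewrite big_nil cexpect0.
under eq_fun do rewrite big_cons.
rewrite big_cons; case: (Q i) => //.
by rewrite cexpectD ?IH //; exact: cintegrable_sum.
Qed.

(** The squared modulus is nonnegative, so its extended-real expectation is already the integral of
    its absolute value. *)
Lemma integrable_cabs_sqr f : cmeasurable f ->
  ('E_P[fun w => (cabs (f w) ^+ 2)%R] < +oo)%E ->
  P.-integrable setT (EFin \o (fun w => cabs (f w) ^+ 2)).
Proof.
move=> [f1 f2] fin; apply/integrableP; split.
  apply/measurable_EFinP; under eq_fun do rewrite cabs_sqrE.
  by apply: measurable_funD; exact: measurable_funX.
by move: fin; rewrite unlock; under eq_integral do
  rewrite -[X in X%:E]ger0_norm ?sqr_ge0 //.
Qed.

Lemma cintegrable_mul_conj f g : cmeasurable f -> cmeasurable g ->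
  ('E_P[fun w => (cabs (f w) ^+ 2)%R] < +oo)%E ->
  ('E_P[fun w => (cabs (g w) ^+ 2)%R] < +oo)%E ->
  cintegrable (fun w => f w * Num.conj (g w)).
Proof.
move=> mf mg ff fg.
have [m1 m2] := cmeasurableM mf (cmeasurable_conj mg).
have ifg := integrableD_EFin (integrable_cabs_sqr mf ff)
                           (integrable_cabs_sqr mg fg).
split; apply: (le_integrable measurableT _ _ ifg);
  [exact/measurable_EFinP| |exact/measurable_EFinP|];
  move=> w _ /=; rewrite lee_fin [leRHS]ger0_norm ?addr_ge0 ?sqr_ge0 //;
  rewrite !cabs_sqrE ?ReM ?ImM; case: (f w) => a b; case: (g w) => a' b' /=;
  rewrite ler_norml; apply/andP; split;
  (* The real part is aa' + bb', bounded through the squares of a ± a' and b ± b'; the imaginary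
     part is ba' - ab', bounded through those of a ± b' and b ± a'. These give the bound with a
     factor 1/2, and the squares of the single variables absorb the slack. *)
  have := (sqr_ge0 (a + a'), sqr_ge0 (a - a'), sqr_ge0 (b + b'), sqr_ge0 (b - b'),
    sqr_ge0 (a + b'), sqr_ge0 (a - b'), sqr_ge0 (b + a'), sqr_ge0 (b - a'));
  move=> [[[[[[[]]]]]]]; have := (sqr_ge0 a, sqr_ge0 b, sqr_ge0 a', sqr_ge0 b');
  move=> [[[]]]; rewrite !expr2; lra.
Qed.

(** * Second moment of a sum of Hermitian products *)

Lemma hdotE n (u v : 'cV[R[i]]_n) :
  hdot u v = \sum_i Num.conj (u i ord0) * v i ord0.
Proof. by rewrite /hdot mxE; apply: eq_bigr => i _; rewrite !mxE. Qed.

(** Groups the deterministic channel coefficients apart from the products of precoder entries, so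
    that linearity of the expectation applies termwise. *)
Lemma hdot_mul_conj n (u u' v v' : 'cV[R[i]]_n) :
  hdot u v * Num.conj (hdot u' v') =
  \sum_i \sum_i' (Num.conj (u i ord0) * u' i' ord0) *
    (v i ord0 * Num.conj (v' i' ord0)).
Proof.
rewrite !hdotE rmorph_sum mulr_suml; apply: eq_bigr => i _.
rewrite mulr_sumr; apply: eq_bigr => i' _.
by rewrite rmorphM /= conjCK mulrACA.
Qed.

Section CorrelatedSum.
Context {I : finType} {n : nat} (V : {set I}) (g : I -> 'cV[R[i]]_n)
  (X : Omega -> I -> 'cV[R[i]]_n).
Hypothesis mX : forall s, mx_measurable (fun w => X w s).
Hypothesis fX : forall s, finite_second_moment P (fun w => X w s).

Lemma cintegrable_hdot_mul_conj s s' :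
  cintegrable (fun w => hdot (g s) (X w s) * Num.conj (hdot (g s') (X w s'))).
Proof.
under eq_fun do rewrite hdot_mul_conj.
apply: cintegrable_sum => i; apply: cintegrable_sum => i'.
by apply: cintegrableZ; apply: cintegrable_mul_conj; (exact: mX || exact: fX).
Qed.

Lemma cexpect_hdot_mul_conj s s' :
  cexpect (fun w => hdot (g s) (X w s) * Num.conj (hdot (g s') (X w s'))) =
  hdot (g s) (expect_mx P (fun w => X w s *m (X w s') ^t*) *m g s').
Proof.
have icorr i i' : cintegrable (fun w => X w s i ord0 * Num.conj (X w s' i' ord0)).
  by apply: cintegrable_mul_conj; (exact: mX || exact: fX).
under eq_fun do rewrite hdot_mul_conj.
rewrite cexpect_sum; last first.
  by move=> i; apply: cintegrable_sum => i'; exact: cintegrableZ.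
rewrite hdotE; apply: eq_bigr => i _.
rewrite cexpect_sum; last by move=> i'; exact: cintegrableZ.
rewrite mxE mulr_sumr; apply: eq_bigr => i' _.
rewrite cexpectZ // -mulrA [in RHS]mxE; congr (_ * _); rewrite mulrC; congr (_ * _).
(* A column times a row: the inner dimension is 1, so the matrix product has a single term. *)
have E w : (X w s *m (X w s') ^t*) i i' = X w s i ord0 * Num.conj (X w s' i' ord0).
  by rewrite mxE big_ord1 !mxE.
by congr (_ +i* _); congr expect; apply: funext => w; rewrite E.
Qed.

Let cabs_sqr_sumE w : cabs (\sum_(s in V) hdot (g s) (X w s)) ^+ 2 =
  complex.Re (\sum_(s in V) \sum_(s' in V)
    hdot (g s) (X w s) * Num.conj (hdot (g s') (X w s'))).
Proof.
rewrite cabs_sqr_Re rmorph_sum mulr_suml; congr complex.Re.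
by apply: eq_bigr => s _; rewrite mulr_sumr.
Qed.

(** Needed to pull the power factors out of [expect] with [expectZ]. The function is the real part
    of a finite sum of integrable cross terms. *)
Lemma integrable_cabs_sqr_sum_hdot :
  P.-integrable setT
    (EFin \o (fun w => cabs (\sum_(s in V) hdot (g s) (X w s)) ^+ 2)).
Proof.
under eq_fun do rewrite /= cabs_sqr_sumE.
by apply: (proj1 (cintegrable_sum _ _ _)) => s; apply: cintegrable_sum => s';
  exact: cintegrable_hdot_mul_conj.
Qed.

Lemma expect_cabs_sqr_sum_hdot :
  expect P (fun w => cabs (\sum_(s in V) hdot (g s) (X w s)) ^+ 2) =
  complex.Re (\sum_(s in V) \sum_(s' in V)
    hdot (g s) (expect_mx P (fun w => X w s *m (X w s') ^t*) *m g s')).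
Proof.
under eq_fun do rewrite cabs_sqr_sumE.
(* The real part commutes with the expectation by definition of [cexpect]. *)
have -> (f : Omega -> R[i]) :
  expect P (fun w => complex.Re (f w)) = complex.Re (cexpect f) by [].
rewrite cexpect_sum; last first.
  by move=> s; apply: cintegrable_sum => s'; exact: cintegrable_hdot_mul_conj.
congr complex.Re; apply: eq_bigr => s _.
rewrite cexpect_sum; last by move=> s'; exact: cintegrable_hdot_mul_conj.
by apply: eq_bigr => s' _; exact: cexpect_hdot_mul_conj.
Qed.

End CorrelatedSum.
End ComplexRandomVariables.

(** * Application to the zero-forcing precoders *)

(** Here a is a transmit power and b a power-control coefficient; nonnegativity matters because
    [Num.sqrt] is 0 on negative numbers. *)
Lemma cabs_sqr_scale {R : realType} (a b : R) (z : R[i]) : 0 <= a -> 0 <= b ->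
  cabs ((Num.sqrt a)%:C * ((Num.sqrt b)%:C * z)) ^+ 2 = a * (b * cabs z ^+ 2).
Proof.
move=> a0 b0; rewrite /cabs !ComplexField.Normc.normcM /= expr0n /= !addr0.
by rewrite !sqrtr_sqr !ger0_norm ?sqrtr_ge0 // !exprMn !sqr_sqrtr.
Qed.

(** Zero divides only zero, while both side lengths of the array are odd and hence nonzero. *)
Lemma nS_gt0 {R : realType} (p : setting R) : (0 < nS p)%N.
Proof.
rewrite lt0n; apply/eqP => n0; have := nS_dvd p; rewrite n0 dvd0n muln_eq0.
by move: (Mx_odd p) (My_odd p); case: (Mx p); case: (My p).
Qed.

(** The cascaded channel is the adjoint of an affine function of [Htil], and the precoder arises
    from it by products, an adjoint and [invmx]. *)
Lemma mx_measurable_wtil_czf {R : realType} (p : setting R)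
    {d : measure_display} {Omega : measurableType d}
    (Htil : Omega -> 'M[R[i]]_(nN p, nM p)) s j :
  mx_measurable Htil -> mx_measurable (fun w => wtil_czf (Htil w) s j).
Proof.
move=> mH.
have mG : mx_measurable (fun w => Gtil (Htil w)).
  move=> m k; under eq_fun do rewrite mxE.
  apply: mx_measurable_adjoint; apply: mx_measurableM.
    exact: mx_measurable_cst.
  apply: mx_measurableD; first exact: mx_measurable_cst.
  by apply: mx_measurableZ => //; exact: cmeasurable_cst.
move=> i i'; under eq_fun do rewrite mxE mxE.
apply: mx_measurableM => //; apply: mx_measurable_inv.
by apply: mx_measurableM => //; exact: mx_measurable_adjoint.
Qed.

Theorem proposition3 (R : realType) (p : setting R)
    (d : measure_display) (Omega : measurableType d) (P : probability Omega R)
    (Htil : Omega -> 'M[R[i]]_(nN p, nM p))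
    (hHtil : iid_complex_gaussian P Htil)
    (hH1 : (H1 p) ^t* *m H1 p \in unitmx)
    (hG : {ae P, forall w,
             (Gtil (Htil w)) ^t* *m Gtil (Htil w) \in unitmx})
    (hw : forall s j, finite_second_moment P (fun w => wtil_czf (Htil w) s j))
    (ebar : 'I_(Kn p) -> R) (etil : 'I_(Kf p) -> R)
    (hebar : forall s k, etan s k = ebar k)
    (hetil : forall s j, etaf s j = etil j)
    (k : 'I_(Kn p)) :
  let wbar := @wbar_czf R p in
  let wtil := fun w => wtil_czf (Htil w) in
  let Delta :=
    Pn p * (\sum_(i | i != k) ebar i *
      cabs (\sum_(s in VRn i) hdot (gbar s k) (wbar s i)) ^+ 2) +
    Pf p * (\sum_j etil j * rcoef P wtil k j) in
  let SINRczf :=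
    Pn p * ebar k *
      cabs (\sum_(s in VRn k) hdot (gbar s k) (wbar s k)) ^+ 2 /
    (Delta + noise k) in
  SINR P wbar wtil k = SINRczf /\ SE P wbar wtil k = log2 (1 + SINRczf).
Proof.
move=> wbar wtil Delta SINRczf.
suff E : SINR P wbar wtil k = SINRczf by split; [|rewrite /SE E].
(* [has_normal_law] carries the measurability of the real and imaginary parts. *)
have mH : mx_measurable Htil.
  by move=> i j; case: (hHtil.1 i j) => [[m1 _] [m2 _] _].
(* Some subarray is needed to transfer nonnegativity from [etan] and [etaf] to the common
   coefficients. *)
pose s0 := Ordinal (nS_gt0 p).
have ebar_ge0 i : 0 <= ebar i by rewrite -(hebar s0); exact: etan_ge0.
have etil_ge0 j : 0 <= etil j by rewrite -(hetil s0); exact: etaf_ge0.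
have Pn0 := ltW (Pn_gt0 p); have Pf0 := ltW (Pf_gt0 p).
have uniE i : cabs (UIn wbar k i) ^+ 2 =
    Pn p * (ebar i * cabs (\sum_(s in VRn i) hdot (gbar s k) (wbar s i)) ^+ 2).
  rewrite -cabs_sqr_scale // /UIn [in RHS]mulr_sumr.
  by under eq_bigr do rewrite hebar.
have uifE j : expect P (fun w => cabs (UIf wtil k j w) ^+ 2) =
    Pf p * (etil j * rcoef P wtil k j).
  (* The constant [Pf p * etil j] is factored out pointwise, before the expectation is taken. *)
  under eq_fun => w.
    rewrite /UIf; under eq_bigr do rewrite hetil.
    rewrite -mulr_sumr cabs_sqr_scale // mulrA; over.
  have mw s := mx_measurable_wtil_czf s j mH.
  rewrite expectZ; last exact: (integrable_cabs_sqr_sum_hdot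
    (VRf j) (fun s => gbar s k) mw (hw ^~ j)).
  by rewrite (expect_cabs_sqr_sum_hdot (VRf j) (fun s => gbar s k) mw (hw ^~ j)) mulrA.
(* The desired signal [DS] of user k is by conversion [UIn] at i = k, so the interference formula
   also gives the numerator. *)
congr (_ / (_ + _ + _)); first by rewrite -mulrA; exact: (uniE k).
  by rewrite mulr_sumr; apply: eq_bigr => i _; exact: uniE.
by rewrite mulr_sumr; apply: eq_bigr => j _; exact: uifE.
Qed.
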